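(* Let $n=12$ and consider the permutations in $S_{12}$ given in one-line notation by $$x=(4,3,8,7,2,1,10,9,6,5,12,11),\qquad y=(4,3,8,7,10,2,12,6,9,1,11,5).$$ Then the singularity of the Schubert variety $Z_y$ along the Schubert cell $C_x$ is isomorphic to the Kashiwara--Saito singularity $S$; that is, the variety $N_x\cap\pi^{-1}(Z_y)$ is isomorphic to the variety $S$, with the point $\dot x$ corresponding to $0\in S$.
   Context: One-line notation: $w=(w_1,\dots,w_n)\in S_n$ is the permutation $i\mapsto w_i$. Let $G=GL_n(\mathbb{C})$, $B\subset G$ the subgroup of upper triangular matrices, $U_-\subset G$ the subgroup of lower triangular unipotent matrices. For $w\in S_n$ let $\dot w$ be the permutation matrix with $\dot w(e_i)=e_{w_i}$. The Schubert cell is $C_w=B\dot wB/B\subset G/B$ and the Schubert variety is $Z_w=\overline{C_w}$. For $x\in S_n$ let $\pi:\dot xU_-\to G/B$, $g\mapsto gB$; it is an open immersion onto a neighbourhood of $\dot xB$. Explicitly, $$\dot xU_-=\{g=(g_{i,j})\in GL_n(\mathbb{C})\mid g_{x_i,i}=1\text{ and }g_{x_i,j}=0\text{ for }j>i\}.$$ Set $$N_x=\{g\in\dot xU_-\mid g_{i,j}=0\text{ for }i<x_j\}.$$ This is a normal slice to $C_x$ in $\dot xU_-$ (meeting $\pi^{-1}(C_x)$ exactly in the point $\dot x$), and the singularity of $Z_y$ along $C_x$ is by definition given by $N_x\cap\pi^{-1}(Z_y)$. The Kashiwara--Saito singularity is the affine variety $$S=\{(M_i)_{i\in\mathbb{Z}/4\mathbb{Z}}\mid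 M_i\in M_2(\mathbb{C}),\ \det M_i=0\text{ and }M_iM_{i+1}=0\text{ for all }i\in\mathbb{Z}/4\mathbb{Z}\}$$ (more precisely, the singularity of $S$ at the point $0=(0,0,0,0)$). *)

(* Defs.v *)
From mathcomp Require Import all_boot all_order all_fingroup all_algebra.
From mathcomp Require Import complex mpoly.
From mathcomp Require Import boolp classical_sets reals.

Set Implicit Arguments.
Unset Strict Implicit.
Unset Printing Implicit Defensive.

Import GRing.Theory.

Local Open Scope classical_set_scope.
Local Open Scope ring_scope.

(* Affine algebraic sets in finite-dimensional vector spaces, with their      *)
(* reduced structure (points over K); K is to be thought of as an             *)
(* algebraically closed field.                                                *)
Section AffineVarieties.
Variable K : fieldType.

(* A polynomial in the coordinates of v; the choice of basis is immaterial.   *)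
Definition polynomial_fun (V : vectType K) (f : V -> K) : Prop :=
  exists p : {mpoly K[\dim {:V}]},
    forall v, f v = p.@[fun i => coord (vbasis {:V}) i v].

Definition polynomial_map (V W : vectType K) (f : V -> W) : Prop :=
  forall i, polynomial_fun (fun v => coord (vbasis {:W}) i (f v)).

Definition zariski_closed (V : vectType K) (X : set V) : Prop :=
  exists2 I : set (V -> K), I `<=` @polynomial_fun V &
    X = [set v | forall f, I f -> f v = 0].

(* Not required to be irreducible. *)
Record affine_variety (V : vectType K) := AffineVariety {
  points : set V;
  points_closed : zariski_closed points }.

(* A morphism between closed subvarieties of V and W is the restriction of a  *)
(* polynomial map V -> W, so both f and its inverse g are given as such maps. *)
Definition pointed_isomorphic (V W : vectType K)
    (X : affine_variety V) (x0 : V) (Y : affine_variety W) (y0 : W) : Prop :=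
  [/\ points X x0, points Y y0 &
    exists (f : V -> W) (g : W -> V),
      [/\ polynomial_map f, polynomial_map g,
          (forall v, points X v -> points Y (f v) /\ g (f v) = v),
          (forall w, points Y w -> points X (g w) /\ f (g w) = w) &
          f x0 = y0]].

Lemma polynomial_fun_cst (V : vectType K) (c : K) :
  polynomial_fun (fun _ : V => c).
Proof. by exists c%:MP => v; rewrite mevalC. Qed.

Lemma polynomial_funD (V : vectType K) (f g : V -> K) :
  polynomial_fun f -> polynomial_fun g -> polynomial_fun (fun v => f v + g v).
Proof. by move=> [p Hp] [q Hq]; exists (p + q) => v; rewrite mevalD Hp Hq. Qed.

Lemma polynomial_funM (V : vectType K) (f g : V -> K) :
  polynomial_fun f -> polynomial_fun g -> polynomial_fun (fun v => f v * g v).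
Proof. by move=> [p Hp] [q Hq]; exists (p * q) => v; rewrite mevalM Hp Hq. Qed.

Lemma polynomial_funB (V : vectType K) (f g : V -> K) :
  polynomial_fun f -> polynomial_fun g -> polynomial_fun (fun v => f v - g v).
Proof. by move=> [p Hp] [q Hq]; exists (p - q) => v; rewrite mevalB Hp Hq. Qed.

Lemma polynomial_fun_sum (V : vectType K) (I : Type) (s : seq I)
    (f : I -> V -> K) :
  (forall i, polynomial_fun (f i)) ->
  polynomial_fun (fun v => \sum_(i <- s) f i v).
Proof.
move=> Hf; elim: s => [|i s IHs].
  have [p Hp] := polynomial_fun_cst V 0.
  by exists p => v; rewrite big_nil (Hp v).
have [p Hp] := polynomial_funD (Hf i) IHs.
by exists p => v; rewrite big_cons (Hp v).
Qed.

Lemma polynomial_fun_linear (V : vectType K) (f : V -> K) :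
  (forall a u v, f (a *: u + v) = a * f u + f v) -> polynomial_fun f.
Proof.
move=> f_lin.
have f0 : f 0 = 0 by move: (f_lin (-1) 0 0); rewrite scaler0 add0r mulN1r addNr.
have fZ a u : f (a *: u) = a * f u by rewrite -[a *: u]addr0 f_lin f0 addr0.
have fD u v : f (u + v) = f u + f v by rewrite -[u]scale1r f_lin mul1r scale1r.
exists (\sum_(i < \dim {:V}) (f (vbasis {:V})`_i)%:MP * 'X_i) => v.
rewrite raddf_sum /=.
under eq_bigr do rewrite mevalM mevalC mevalXU.
rewrite [in LHS](coord_vbasis (memvf v)) (big_morph f fD f0).
by apply: eq_bigr => i _; rewrite fZ mulrC.
Qed.

Lemma zariski_closedI (V : vectType K) (X Y : set V) :
  zariski_closed X -> zariski_closed Y -> zariski_closed (X `&` Y).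
Proof.
move=> [I HI ->] [J HJ ->]; exists (I `|` J); first by move=> f [/HI|/HJ].
apply/seteqP; split=> [v [HX HY] f [|]|v H]; [exact: HX|exact: HY|].
by split=> f Hf; apply: H; [left|right].
Qed.

Lemma zariski_closed_bigcap (V : vectType K) (T : Type) (P : set T)
    (X : T -> set V) :
  (forall t, P t -> zariski_closed (X t)) ->
  zariski_closed (\bigcap_(t in P) X t).
Proof.
move=> HX.
exists [set f | polynomial_fun f /\
                forall v, (\bigcap_(t in P) X t) v -> f v = 0].
  by move=> f [].
apply/seteqP; split=> [v Hv f [_]|v H t Pt]; first exact.
have [I HI XE] := HX t Pt; rewrite XE => f If.
by apply: H; split; [exact: HI|move=> w /(_ t Pt); rewrite XE; apply].
Qed.

Lemma zariski_closed_zero (V : vectType K) (f : V -> K) :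
  polynomial_fun f -> zariski_closed [set v | f v = 0].
Proof.
move=> Hf; exists [set f]; first by move=> g ->.
by apply/seteqP; split=> [v Hv g ->|v]; [|exact].
Qed.

End AffineVarieties.

Section Schubert.
Variables (K : fieldType) (n : nat).
Implicit Types (x y w : 'S_n) (g : 'M[K]_n).

Definition GL : set 'M[K]_n := [set g | g \in unitmx].

Definition borel : set 'M[K]_n :=
  [set b | GL b /\ forall i j : 'I_n, (j < i)%N -> b i j = 0].

Definition lower_unipotent : set 'M[K]_n :=
  [set u | (forall i, u i i = 1) /\ forall i j : 'I_n, (i < j)%N -> u i j = 0].

(* Sends e_j to e_(w j); this is the transpose of the library's perm_mx w. *)
Definition permutation_matrix w : 'M[K]_n := \matrix_(i, j) (i == w j)%:R.

(* The point gB of G/B, as a subset of G. *)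
Definition flag_pt g : set 'M[K]_n := [set g *m b | b in borel].

Definition flag_variety : set (set 'M[K]_n) := flag_pt @` GL.

Definition GL_closed (A : set 'M[K]_n) : Prop :=
  exists2 F : set 'M[K]_n, zariski_closed F & A = GL `&` F.

(* The Zariski topology of G/B is the quotient topology under G -> G/B. *)
Definition flag_closed (Z : set (set 'M[K]_n)) : Prop :=
  Z `<=` flag_variety /\ GL_closed (GL `&` flag_pt @^-1` Z).

Definition flag_closure (Z : set (set 'M[K]_n)) : set (set 'M[K]_n) :=
  \bigcap_(F in [set F | flag_closed F /\ Z `<=` F]) F.

Definition schubert_cell w : set (set 'M[K]_n) :=
  flag_pt @` [set b *m permutation_matrix w *m b' | b in borel & b' in borel].

Definition schubert_variety w : set (set 'M[K]_n) :=
  flag_closure (schubert_cell w).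

Definition opposite_chart x : set 'M[K]_n :=
  [set permutation_matrix x *m u | u in lower_unipotent].

Definition normal_slice x : set 'M[K]_n :=
  [set g | opposite_chart x g /\ forall i j : 'I_n, (i < x j)%N -> g i j = 0].

Definition slice_schubert_set x y : set 'M[K]_n :=
  normal_slice x `&` flag_pt @^-1` schubert_variety y.

Lemma permutation_matrixE w (A : 'M[K]_n) i j :
  (permutation_matrix w *m A) (w i) j = A i j.
Proof.
rewrite mxE (bigD1 i) //= mxE eqxx mul1r big1 ?addr0 // => k ki.
by rewrite mxE (inj_eq perm_inj) eq_sym (negPf ki) mul0r.
Qed.

Lemma opposite_chartE x :
  opposite_chart x =
  [set g : 'M[K]_n | (forall i, g (x i) i = 1) /\
           forall i j : 'I_n, (i < j)%N -> g (x i) j = 0].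
Proof.
apply/seteqP; split=> [_ [u [u1 u0] <-]|g [g1 g0]].
  by split=> [i|i j ij]; rewrite permutation_matrixE ?u1 ?u0.
exists (\matrix_(i, j) g (x i) j).
  by split=> [i|i j ij]; rewrite mxE ?g1 ?g0.
apply/matrixP => i j; rewrite -(permKV x i).
by rewrite permutation_matrixE mxE.
Qed.

Lemma polynomial_fun_entry i j : polynomial_fun (fun g : 'M[K]_n => g i j).
Proof. by apply: polynomial_fun_linear => a u v; rewrite !mxE. Qed.

Lemma zariski_closed_entry i j (c : K) :
  zariski_closed [set g : 'M[K]_n | g i j = c].
Proof.
have -> : [set g : 'M[K]_n | g i j = c] = [set g | g i j - c = 0].
  by apply/seteqP; split=> g /= /eqP H; apply/eqP; move: H; rewrite subr_eq0.
apply/zariski_closed_zero/polynomial_funB; first exact: polynomial_fun_entry.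
exact: polynomial_fun_cst.
Qed.

Lemma opposite_chart_GL x : opposite_chart x `<=` GL.
Proof.
move=> _ [u [u1 u0] <-]; rewrite /GL /= unitmx_mul; apply/andP; split.
  suff -> : permutation_matrix x = (perm_mx x)^T.
    by rewrite unitmx_tr unitmx_perm.
  by apply/matrixP => i j; rewrite !mxE eq_sym.
rewrite unitmxE det_trig; last by apply/is_trig_mxP => i j /u0.
by rewrite big1 ?unitr1.
Qed.

Lemma normal_slice_closed x : zariski_closed (normal_slice x).
Proof.
have -> : normal_slice x =
    \bigcap_i [set g : 'M[K]_n | g (x i) i = 1] `&`
    (\bigcap_(p in [set p : 'I_n * 'I_n | (p.1 < p.2)%N])
       [set g : 'M[K]_n | g (x p.1) p.2 = 0] `&`
     \bigcap_(p in [set p : 'I_n * 'I_n | (p.1 < x p.2)%N])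
       [set g : 'M[K]_n | g p.1 p.2 = 0]).
  rewrite /normal_slice opposite_chartE.
  apply/seteqP; split=> [g [[g1 g0] gs]|g [g1 [g0 gs]]].
    by split=> [i _|]; [exact: g1|split=> -[i j] /=; [exact: g0|exact: gs]].
  split; first by split=> [i|i j ij]; [exact: g1|exact: (g0 (i, j))].
  by move=> i j ij; exact: (gs (i, j)).
by do ?[apply: zariski_closedI]; apply: zariski_closed_bigcap => p _;
  exact: zariski_closed_entry.
Qed.

Lemma slice_schubert_closed x y : zariski_closed (slice_schubert_set x y).
Proof.
pose P : set (set 'M[K]_n) := [set A | zariski_closed A /\ exists F,
  [/\ flag_closed F, schubert_cell y `<=` F &
      GL `&` flag_pt @^-1` F = GL `&` A]].
have -> : slice_schubert_set x y = normal_slice x `&` \bigcap_(A in P) A.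
  apply/seteqP; split=> g [gN gZ]; (split; first exact: gN).
    have gG : GL g by case: gN => /opposite_chart_GL.
    move=> A [_ [F [Fc yF FA]]].
    have [] : (GL `&` A) g by rewrite -FA; split=> //; exact: gZ.
    by [].
  have gG : GL g by case: gN => /opposite_chart_GL.
  move=> F [[Fs [A Ac FA]] yF].
  have [] : (GL `&` flag_pt @^-1` F) g.
    rewrite FA; split=> //; apply: gZ; split=> //; exists F; split=> //.
    by split=> //; exists A.
  by [].
apply: zariski_closedI; first exact: normal_slice_closed.
by apply: zariski_closed_bigcap => A [].
Qed.

(* The singularity of Z_y along C_x, with base point permutation_matrix x. *)
Definition slice_schubert x y : affine_variety 'M[K]_n :=
  AffineVariety (slice_schubert_closed x y).

(* One-line notation is 1-based: [:: w_1; ...; w_n]. *)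
Definition one_line w : seq nat := [seq (w i).+1 | i <- enum 'I_n].

End Schubert.

Section KashiwaraSaito.
Variable K : fieldType.

Definition kashiwara_saito_set : set {ffun 'Z_4 -> 'M[K]_2} :=
  [set M | forall i, \det (M i) = 0 /\ M i *m M (i + 1) = 0].

Lemma det_mx22 (A : 'M[K]_2) : \det A = A 0 0 * A 1 1 - A 0 1 * A 1 0.
Proof.
rewrite (expand_det_row _ 0) !big_ord_recl big_ord0 addr0 /cofactor.
rewrite !det_mx11 !mxE expr0 expr1 mul1r mulN1r mulrN.
by congr (_ * A _ _ - A _ _ * A _ _); exact/val_inj.
Qed.

Lemma kashiwara_saito_closed : zariski_closed kashiwara_saito_set.
Proof.
have entry i a b :
    polynomial_fun (fun M : {ffun 'Z_4 -> 'M[K]_2} => M i a b).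
  by apply: polynomial_fun_linear => c M N; rewrite !ffunE !mxE.
have -> : kashiwara_saito_set =
    \bigcap_i [set M : {ffun 'Z_4 -> 'M[K]_2} |
                 M i 0 0 * M i 1 1 - M i 0 1 * M i 1 0 = 0] `&`
    \bigcap_(p : 'Z_4 * ('I_2 * 'I_2))
      [set M : {ffun 'Z_4 -> 'M[K]_2} |
         \sum_k M p.1 p.2.1 k * M (p.1 + 1) k p.2.2 = 0].
  apply/seteqP; split=> [M HM|M [Hd Hm] i].
    split=> [i _|[i [a b]] _] /=; have [Hd Hm] := HM i.
      by rewrite -det_mx22.
    by move/matrixP: Hm => /(_ a b); rewrite !mxE.
  split; first by rewrite det_mx22; exact: Hd.
  by apply/matrixP => a b; rewrite !mxE; exact: (Hm (i, (a, b)) I).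
apply: zariski_closedI; apply: zariski_closed_bigcap => i _;
  apply: zariski_closed_zero.
  by apply: polynomial_funB; apply: polynomial_funM; exact: entry.
by apply: polynomial_fun_sum => k; apply: polynomial_funM; exact: entry.
Qed.

Definition kashiwara_saito : affine_variety {ffun 'Z_4 -> 'M[K]_2} :=
  AffineVariety kashiwara_saito_closed.

End KashiwaraSaito.

(* Main.v *)
Require Import Defs.
From mathcomp Require Import all_boot all_order all_fingroup all_algebra.
From mathcomp Require Import ring zify.
From mathcomp Require Import complex mpoly.
From mathcomp Require Import boolp classical_sets reals.

(* In 2x2 blocks, a point of the slice lying in Z_y has only four free blocks *)
(* that can be nonzero: A, B in columns 5-6 (rows 5-6, resp. 9-10) and C, D   *)
(* in rows 11-12 (columns 7-8, resp. 9-10). With A', B' obtained from A, B by *)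
(* exchanging the two rows, the rank conditions on south-west corners say     *)
(* that A, B stacked and C, D side by side have rank at most 1, and that      *)
(* C B' = 0 and D A' = 0. Hence (A', adj B', adj C, D) is a point of S.       *)
(* Conversely each point of S is M_k = a_k u_k (perp u_(k+1))^T for some      *)
(* vectors u_k and scalars a_k. When all entries of the M_k are nonzero, an   *)
(* explicit upper triangular matrix shows that the point of the slice lies in *)
(* the cell of y; the general case follows by moving the parameters u_k, a_k  *)
(* along a line, since a polynomial in one variable over an infinite field    *)
(* that vanishes at all but finitely many points is zero.                     *)

Set Implicit Arguments.
Unset Strict Implicit.
Unset Printing Implicit Defensive.

Import GRing.Theory.

Local Open Scope classical_set_scope.
Local Open Scope ring_scope.

(** The isomorphism is affine-linear both ways: [slice_mx] writes the entries of a quadruple, up to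
    sign, into the four free blocks, and [slice_coords] reads them back. Only the sets of points
    have to be compared. From the slice to S: on the cell of [y], a minor in rows from p on and
    columns before q vanishes once its size exceeds the number of l < q with p <= y(l), and it still
    vanishes on the closure ([schubert_variety_minor]). Minors of size 1 clear the entries outside
    the blocks ([slice_coordsK]); minors of size 2, 3, 4 and 7 give the equations of S
    ([slice_mx_kashiwara_saito]). From S to the slice: [kashiwara_saito_ks_point] makes S the image
    of an affine space, and parameters with all matrix entries nonzero land in the cell itself
    ([slice_mx_cell]). A polynomial vanishing on the cell restricts to a one-variable polynomial on
    a line of parameters, hence vanishes at every point of S ([slice_mx_schubert_variety]). *)

(** * Polynomial functions and maps *)

Lemma polynomial_funN (K : fieldType) (V : vectType K) (f : V -> K) :
  polynomial_fun f -> polynomial_fun (fun v => - f v).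
Proof. by move=> [p Hp]; exists (- p) => v; rewrite mevalN Hp. Qed.

Lemma polynomial_fun_prod (K : fieldType) (V : vectType K) (I : Type)
    (s : seq I) (f : I -> V -> K) :
  (forall i, polynomial_fun (f i)) ->
  polynomial_fun (fun v => \prod_(i <- s) f i v).
Proof.
move=> Hf; elim: s => [|i s IHs].
  have [p Hp] := polynomial_fun_cst V 1.
  by exists p => v; rewrite big_nil (Hp v).
have [p Hp] := polynomial_funM (Hf i) IHs.
by exists p => v; rewrite big_cons (Hp v).
Qed.

Lemma polynomial_funX (K : fieldType) (V : vectType K) (f : V -> K) n :
  polynomial_fun f -> polynomial_fun (fun v => f v ^+ n).
Proof. by move=> [p Hp]; exists (p ^+ n) => v; rewrite rmorphXn /= Hp. Qed.

Lemma polynomial_fun_comp (K : fieldType) (V W : vectType K)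
    (phi : V -> W) (f : W -> K) :
  polynomial_map phi -> polynomial_fun f -> polynomial_fun (f \o phi).
Proof.
move=> phiP [p fE].
have -> : f \o phi = fun v => \sum_(m <- msupp p)
    (p@_m * \prod_i coord (vbasis {:W}) i (phi v) ^+ m i).
  by apply/funext => v; rewrite /= fE mevalE.
apply: polynomial_fun_sum => m; apply: polynomial_funM.
  exact: polynomial_fun_cst.
by apply: polynomial_fun_prod => i; apply/polynomial_funX/phiP.
Qed.

(** The vectors [e] are arbitrary, so polynomiality can be tested on matrix units instead of the
    unspecified [vbasis]. *)
Lemma polynomial_map_comb (K : fieldType) (V W : vectType K) (I : Type)
    (s : seq I) (c : I -> V -> K) (e : I -> W) (phi : V -> W) :
  (forall i, polynomial_fun (c i)) ->
  (forall v, phi v = \sum_(i <- s) c i v *: e i) -> polynomial_map phi.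
Proof.
move=> cP phiE j.
have -> : (fun v => coord (vbasis {:W}) j (phi v)) =
    fun v => \sum_(i <- s) c i v * coord (vbasis {:W}) j (e i).
  apply/funext => v; rewrite phiE linear_sum; apply: eq_bigr => i _.
  by rewrite linearZ.
by apply: polynomial_fun_sum => i; apply: polynomial_funM => //;
  exact: polynomial_fun_cst.
Qed.

Lemma polynomial_map_mx (K : fieldType) (V : vectType K) m n
    (phi : V -> 'M[K]_(m, n)) :
  (forall i j, polynomial_fun (fun v => phi v i j)) -> polynomial_map phi.
Proof.
move=> phiP.
apply: (polynomial_map_comb (s := index_enum ('I_m * 'I_n)%type)
  (c := fun p v => phi v p.1 p.2) (e := fun p => delta_mx p.1 p.2)).
  by move=> p; exact: phiP.
by move=> v; rewrite [LHS]matrix_sum_delta pair_bigA.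
Qed.

Lemma polynomial_map_ffun_mx (K : fieldType) (V : vectType K) (I : finType)
    m n (phi : V -> {ffun I -> 'M[K]_(m, n)}) :
  (forall k i j, polynomial_fun (fun v => phi v k i j)) -> polynomial_map phi.
Proof.
move=> phiP.
apply: (polynomial_map_comb (s := index_enum (I * ('I_m * 'I_n))%type)
  (c := fun p v => phi v p.1 p.2.1 p.2.2)
  (e := fun p => [ffun k => if k == p.1 then delta_mx p.2.1 p.2.2 else 0])).
  by move=> p; exact: phiP.
move=> v; apply/ffunP => k; rewrite sum_ffunE.
rewrite -(pair_bigA _ (fun l q => (phi v l q.1 q.2 *:
  [ffun k0 => if k0 == l then delta_mx q.1 q.2 else 0]
    : {ffun I -> 'M[K]_(m, n)}) k)) /=.
rewrite (bigD1 k) //= [X in _ + X]big1 ?addr0 => [|l lk].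
  rewrite [LHS]matrix_sum_delta pair_bigA; apply: eq_bigr => q _.
  by rewrite !ffunE eqxx.
by rewrite big1 // => q _; rewrite !ffunE eq_sym (negPf lk) scaler0.
Qed.

Lemma polynomial_fun_det (K : fieldType) (V : vectType K) n
    (phi : V -> 'M[K]_n) :
  (forall i j, polynomial_fun (fun v => phi v i j)) ->
  polynomial_fun (fun v => \det (phi v)).
Proof.
move=> phiP; apply: polynomial_fun_sum => s.
apply: polynomial_funM; first exact: polynomial_fun_cst.
by apply: polynomial_fun_prod => i.
Qed.

Lemma polynomial_fun_ffun_entry (K : fieldType) (I : finType) m n k i j :
  polynomial_fun (fun M : {ffun I -> 'M[K]_(m, n)} => M k i j).
Proof. by apply: polynomial_fun_linear => a u v; rewrite !ffunE !mxE. Qed.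

(** * Polynomials on a line in characteristic zero *)

(** The chosen basis vector of [K^o] need not be 1, so the coordinate of t is a constant times t;
    this is the factor in [X]. *)
Lemma polynomial_fun_regular (K : fieldType) (F : K^o -> K) :
  polynomial_fun F -> exists q : {poly K}, forall t, F t = q.[t].
Proof.
move=> [p FE]; pose X i : {poly K} := coord (vbasis {:K^o}) i (1 : K^o) *: 'X.
exists (\sum_(m <- msupp p) ((p@_m)%:P * \prod_i X i ^+ m i)) => t.
rewrite FE mevalE horner_sum; apply: eq_bigr => m _.
rewrite hornerM hornerC horner_prod; congr (_ * _); apply: eq_bigr => i _.
rewrite horner_exp hornerZ hornerX; congr (_ ^+ _).
by rewrite -[in LHS](mulr1 t) -[t * 1]/(t *: (1 : K^o)) linearZ /= mulrC.
Qed.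

(** In characteristic zero the first [size q] natural numbers are distinct roots, one more than the
    degree allows. *)
Lemma poly_eq0_char0 (K : fieldType) (q : {poly K}) :
  [pchar K] =i pred0 -> (forall t, q.[t] = 0) -> q = 0.
Proof.
move=> /pcharf0P K0 q0; apply/eqP/negPn/negP => qn0.
suff : (size [seq (i%:R : K) | i <- iota 0 (size q)] < size q)%N.
  by rewrite size_map size_iota ltnn.
apply: max_poly_roots => //.
  by apply/allP => _ /mapP[i _ ->]; apply/eqP; exact: q0.
rewrite map_inj_uniq ?iota_uniq // => i j ij.
wlog le_ij : i j ij / (i <= j)%N.
  by case/orP: (leq_total i j) => le H; [|symmetry]; exact: H.
by apply/eqP; rewrite eqn_leq le_ij -subn_eq0 -K0 natrB // ij subrr eqxx.
Qed.

Lemma polynomial_fun_eq0_generic (K : fieldType) (F : K^o -> K) (h : {poly K}) :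
  [pchar K] =i pred0 -> polynomial_fun F -> h != 0 ->
  (forall t, h.[t] != 0 -> F t = 0) -> forall t, F t = 0.
Proof.
move=> K0 /polynomial_fun_regular[q FE] h0 Fh t.
(* Multiplying by [h] absorbs the exceptional points: the product vanishes everywhere. *)
suff /eqP : q * h = 0.
  by rewrite mulf_eq0 (negPf h0) orbF FE => /eqP ->; rewrite horner0.
apply: poly_eq0_char0 => // s; rewrite hornerM.
have [->|/Fh] := eqVneq h.[s] 0; first by rewrite mulr0.
by rewrite FE => ->; rewrite mul0r.
Qed.

(** * The Borel subgroup, Schubert cells and their closures *)

Lemma borel1 (K : fieldType) n : borel (1%:M : 'M[K]_n).
Proof.
split; first exact: unitmx1.
by move=> i j ji; rewrite mxE -val_eqE gtn_eqF.
Qed.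

Lemma borelM (K : fieldType) n (b c : 'M[K]_n) :
  borel b -> borel c -> borel (b *m c).
Proof.
move=> [bG b0] [cG c0]; split; first by rewrite /GL /= unitmx_mul bG.
move=> i j ji; rewrite mxE big1 // => k _.
have [ki|ik] := ltnP k i; first by rewrite b0 ?mul0r.
by rewrite c0 ?mulr0 // (leq_trans ji).
Qed.

Lemma borel_diag (K : fieldType) n (b : 'M[K]_n) :
  (forall i j : 'I_n, (j < i)%N -> b i j = 0) -> (forall i, b i i != 0) ->
  borel b.
Proof.
move=> b0 b1; split=> //; rewrite /GL /= unitmxE -det_tr det_trig.
  by rewrite unitfE; apply/prodf_neq0 => i _; rewrite mxE.
by apply/is_trig_mxP => i j ij; rewrite mxE b0.
Qed.

Lemma borelV (K : fieldType) n (b : 'M[K]_n) : borel b -> borel (invmx b).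
Proof.
move=> [bG b0]; split; first by rewrite /GL /= unitmx_inv.
have b1 i : b i i != 0.
  move: bG; rewrite /GL /= unitmxE unitfE -det_tr det_trig.
    by move/prodf_neq0 => /(_ i isT); rewrite mxE.
  by apply/is_trig_mxP => k j kj; rewrite mxE b0.
(* Descending induction on the row: once the lower rows of the inverse vanish left of the diagonal,
   entry (i, j) of b times its inverse reduces to one term with the nonzero factor [b i i]. *)
move=> i; move: {2}(n - i)%N (leqnn (n - i)%N) => m.
elim: m i => [|m IHm] i; first by rewrite leqn0 subn_eq0 leqNgt ltn_ord.
move=> im j ji; have /matrixP/(_ i j) := mulmxV bG.
rewrite !mxE (bigD1 i) //= big1 => [|k ki].
  rewrite addr0 -val_eqE gtn_eqF //= => /eqP.
  by rewrite mulf_eq0 (negPf (b1 i)) => /eqP.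
have [lt_ki|le_ik] := ltnP k i; first by rewrite b0 ?mul0r.
have lt_ik : (i < k)%N by rewrite ltn_neqAle le_ik andbT eq_sym.
rewrite IHm ?mulr0 ?(ltn_trans ji) //.
by rewrite -ltnS (leq_trans _ im) // ltn_sub2l.
Qed.

Lemma flag_pt_refl (K : fieldType) n (g : 'M[K]_n) : flag_pt g g.
Proof. by exists 1%:M; [exact: borel1|rewrite mulmx1]. Qed.

(* The common zeros of the translates h |-> f (h b) form a right B-stable     *)
(* closed set, hence descend to a closed subset of G/B.                       *)
Lemma schubert_variety_vanish (K : fieldType) n (w : 'S_n) (f : 'M[K]_n -> K)
    (g : 'M[K]_n) :
  polynomial_fun f ->
  (forall b c, borel b -> borel c ->
     f (b *m permutation_matrix K w *m c) = 0) ->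
  GL g -> schubert_variety w (flag_pt g) -> f g = 0.
Proof.
move=> fP f0 gG gZ.
pose A := [set h : 'M[K]_n | forall b, borel b -> f (h *m b) = 0].
suff [h [hG hA] hg] : (@flag_pt K n @` (@GL K n `&` A)) (flag_pt g).
  have : flag_pt h g by rewrite hg; exact: flag_pt_refl.
  by move=> [b bB <-]; exact: hA.
apply: gZ; split; last first.
  move=> _ [_ [b bB [c cB <-]] <-].
  exists (b *m permutation_matrix K w *m c) => //.
  split.
    have wG : permutation_matrix K w \in unitmx.
      apply: opposite_chart_GL; exists 1%:M; last by rewrite mulmx1.
      by split=> [i|i j ij]; rewrite mxE ?eqxx // -val_eqE ltn_eqF.
    by rewrite /GL /= !unitmx_mul wG (proj1 bB) (proj1 cB).
  by move=> d dB; rewrite -mulmxA f0 //; exact: borelM.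
split; first by move=> _ [h [hG _] <-]; exists h.
exists A.
  have -> : A = \bigcap_(b in @borel K n) [set h | f (h *m b) = 0] by [].
  apply: zariski_closed_bigcap => b _; apply: zariski_closed_zero.
  apply: (@polynomial_fun_comp _ _ _ (fun h => h *m b)) => //.
  apply: polynomial_map_mx => i j; apply: polynomial_fun_linear => a u v.
  by rewrite mulmxDl -scalemxAl !mxE.
apply/seteqP; split=> h [hG hA]; split=> //.
  case: hA => h' [_ h'A] h'h b bB.
  have : flag_pt h' h by rewrite h'h; exact: flag_pt_refl.
  by move=> [c cB <-]; rewrite -mulmxA; apply/h'A/borelM.
by exists h.
Qed.

(** The preimage in GL of a closed set of flags containing the cell is cut out by polynomials; these
    vanish on the cell, hence at [g]. *)
Lemma schubert_variety_dense (K : fieldType) n (w : 'S_n) (g : 'M[K]_n) :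
  GL g ->
  (forall f, polynomial_fun f ->
    (forall h, GL h -> schubert_cell w (flag_pt h) -> f h = 0) -> f g = 0) ->
  schubert_variety w (flag_pt g).
Proof.
move=> gG gf F [[_ [A [I IP AE] FA]] wF].
suff [] : (@GL K n `&` @flag_pt K n @^-1` F) g by [].
rewrite FA; split=> //; rewrite AE => f If; apply: gf; first exact: IP.
move=> h hG /wF Fh.
suff [_] : (@GL K n `&` A) h by rewrite AE; apply.
by rewrite -FA.
Qed.

(** The hypotheses say that [b *m g], with its rows permuted by [w], is upper triangular and
    invertible, which is a Bruhat factorization of [g]. *)
Lemma schubert_cell_pivot (K : fieldType) n (w : 'S_n) (b g : 'M[K]_n) :
  borel b -> (forall i j : 'I_n, (j < i)%N -> (b *m g) (w i) j = 0) ->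
  (forall i, (b *m g) (w i) i != 0) -> schubert_cell w (flag_pt g).
Proof.
move=> bB bg0 bg1; exists g => //.
exists (invmx b); first exact: borelV.
exists (\matrix_(i, j) (b *m g) (w i) j).
  by apply: borel_diag => [i j ji|i]; rewrite mxE ?bg1 ?bg0.
rewrite -mulmxA -[RHS](mulKmx (proj1 bB)); congr (_ *m _).
by apply/matrixP => i j; rewrite -(permKV w i) permutation_matrixE mxE.
Qed.

(* An entry (f i, h j) of b w c only involves the l with f i <= w l and       *)
(* l <= h j, so the submatrix factors through fewer than k dimensions.        *)
Lemma schubert_cell_minor (K : fieldType) n (w : 'S_n) k p q
    (f h : 'I_k -> 'I_n) (b c : 'M[K]_n) :
  (forall i, p <= f i)%N -> (forall j, h j < q)%N ->
  (#|[pred l : 'I_n | (l < q) && (p <= w l)]| < k)%N ->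
  borel b -> borel c ->
  \det (mxsub f h (b *m permutation_matrix K w *m c)) = 0.
Proof.
move=> fp hq; set L := [pred l | _] => Lk [_ b0] [_ c0].
have -> : mxsub f h (b *m permutation_matrix K w *m c) =
    (\matrix_(i < k, l < #|L|) b (f i) (w (enum_val l))) *m
    (\matrix_(l < #|L|, j < k) c (enum_val l) (h j)).
  apply/matrixP => i j; rewrite !mxE.
  under [RHS]eq_bigr do rewrite !mxE.
  rewrite -(@big_enum_val _ _ _ _ L (fun l => b (f i) (w l) * c l (h j))) /=.
  rewrite [RHS]big_mkcond; apply: eq_bigr => l _.
  rewrite mxE (bigD1 (w l)) //= mxE eqxx mulr1.
  rewrite big1 ?addr0 => [|m ml]; last first.
    by rewrite mxE (negPf ml) mulr0.
  rewrite inE; have [lq|ql] /= := ltnP l q; last first.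
    by rewrite c0 ?mulr0 // (leq_trans (hq j)).
  by have [//|wp] := leqP p (w l); rewrite b0 ?mul0r // (leq_trans wp).
apply/eqP/negPn/negP; rewrite -unitfE -unitmxE => /mxrank_unit rk.
have := mxrankM_maxl (\matrix_(i < k, l < #|L|) b (f i) (w (enum_val l))) 
  (\matrix_(l < #|L|, j < k) c (enum_val l) (h j)).
by rewrite rk => /leq_trans/(_ (rank_leq_col _)); rewrite leqNgt Lk.
Qed.

Lemma schubert_variety_minor (K : fieldType) n (w : 'S_n) k p q
    (f h : 'I_k -> 'I_n) (g : 'M[K]_n) :
  (forall i, p <= f i)%N -> (forall j, h j < q)%N ->
  (#|[pred l : 'I_n | (l < q) && (p <= w l)]| < k)%N ->
  GL g -> schubert_variety w (flag_pt g) -> \det (mxsub f h g) = 0.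
Proof.
move=> fp hq Lk.
apply: (schubert_variety_vanish (f := fun g => \det (mxsub f h g))).
  apply: polynomial_fun_det => i j.
  by apply: polynomial_fun_linear => a u v; rewrite !mxE.
by move=> b c bB cB; exact: (schubert_cell_minor fp hq Lk).
Qed.

(** * Coordinates on the normal slice *)

Definition x_line : seq nat := [:: 4; 3; 8; 7; 2; 1; 10; 9; 6; 5; 12; 11]%N.
Definition y_line : seq nat := [:: 4; 3; 8; 7; 10; 2; 12; 6; 9; 1; 11; 5]%N.

Lemma one_line_nth n (w : 'S_n) s (i : 'I_n) :
  one_line w = s -> (w i).+1 = nth 0%N s i.
Proof.
move=> <-; rewrite /one_line (nth_map i) ?nth_ord_enum //.
by rewrite size_enum_ord.
Qed.

(* Indices start at 0: this is the entry g_(r+1, c+1) of the paper.           *)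
Definition entry (K : fieldType) (g : 'M[K]_12) (r c : nat) : K :=
  g (inord r) (inord c).

Lemma entryE (K : fieldType) (F : nat -> nat -> K) r c :
  (r < 12)%N -> (c < 12)%N ->
  entry (\matrix_(i < 12, j < 12) F i j) r c = F r c.
Proof. by move=> r12 c12; rewrite /entry mxE !inordK. Qed.

(** Turns the slice conditions into a test that computes on numerals; [index r.+1 x_line] is the
    column of the 1 in row r. *)
Lemma normal_slice_entry (K : fieldType) (x : 'S_12) (g : 'M[K]_12) :
  one_line x = x_line ->
  normal_slice x g <->
  forall r c, (r < 12)%N -> (c < 12)%N ->
    if (r.+1 == nth 0 x_line c)%N then entry g r c = 1 else
    (index r.+1 x_line < c)%N || (r.+1 < nth 0 x_line c)%N -> entry g r c = 0.
Proof.
move=> /one_line_nth xE; rewrite /normal_slice opposite_chartE.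
split=> [[[g1 g0] gs] r c r12 c12|gE].
  have xc : (x (inord c)).+1 = nth 0%N x_line c by rewrite xE inordK.
  case: eqP => [rc|_].
    rewrite /entry (_ : inord r = x (inord c)) ?g1 //.
    by apply/val_inj; rewrite /= inordK //; apply/succn_inj; rewrite rc.
  case/orP=> [rc|rc]; last by apply: gs; rewrite inordK // -ltnS xc.
  pose k := index r.+1 x_line.
  have k12 : (k < 12)%N by exact: ltn_trans c12.
  have rk : inord r = x (inord k).
    apply/val_inj; rewrite /= inordK //; apply/succn_inj; rewrite xE inordK //.
    by rewrite nth_index // -index_mem.
  by rewrite /entry rk g0 // !inordK.
have gE' (i j : 'I_12) : entry g i j = g i j by rewrite /entry !inord_val.
split; first split.
- by move=> i; have := gE (x i) i (ltn_ord _) (ltn_ord _); rewrite xE eqxx gE'.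
- move=> i j ij; have := gE (x i) j (ltn_ord _) (ltn_ord _).
  have i12 := ltn_ord i; have j12 := ltn_ord j.
  rewrite xE nth_uniq // -[X in if X then _ else _]/(i == j) -val_eqE.
  rewrite ltn_eqF //.
  by rewrite index_uniq // ij gE'; apply.
- move=> i j ij; have := gE i j (ltn_ord _) (ltn_ord _).
  by rewrite -xE eqSS ltn_eqF // ltnS ij orbT gE'; apply.
Qed.

(** A vanishing minor is stated as a nonzero left kernel vector, so that no large determinant has to
    be expanded. *)
Lemma schubert_minor_relation (K : fieldType) (y : 'S_12) (g : 'M[K]_12)
    (p q : nat) (rows cols : seq nat) :
  one_line y = y_line -> GL g -> schubert_variety y (flag_pt g) ->
  size rows = size cols ->
  all (fun r => p <= r < 12)%N rows -> all (fun c => c < q)%N cols ->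
  (q <= 12)%N ->
  (count (fun l => (l < q) && (p < nth 0 y_line l)) (iota 0 12)
     < size rows)%N ->
  exists v : nat -> K,
    ~ (forall i, (i < size rows)%N -> v i = 0) /\
    (forall j, (j < size cols)%N ->
      \sum_(0 <= i < size rows)
        v i * entry g (nth 0 rows i)%N (nth 0 cols j)%N = 0).
Proof.
move=> /one_line_nth yE gG gZ rc rowsP colsP q12 yc.
pose f (i : 'I_(size rows)) : 'I_12 := inord (nth 0 rows i)%N.
pose h (j : 'I_(size rows)) : 'I_12 := inord (nth 0 cols j)%N.
have fE i : (p <= f i)%N.
  have /allP/(_ (nth 0 rows i)%N) := rowsP; rewrite mem_nth // => /(_ isT).
  by move=> /andP[pi i12]; rewrite inordK.
have hE j : (h j < q)%N.
  have /allP/(_ (nth 0 cols j)%N) := colsP; rewrite mem_nth -?rc // => /(_ isT).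
  by move=> jq; rewrite inordK // (leq_trans jq).
have /det0P[v v0 vM] : \det (mxsub f h g) == 0.
  apply/eqP; apply: (schubert_variety_minor (w := y) (p := p) (q := q)) => //.
  apply: leq_ltn_trans yc.
  (* [y_line] is 1-based, so [p < nth 0 y_line l] means [p <= y l]. *)
  rewrite -sum1_card -sum1_count -[iota 0 12]/(index_iota 0 12) big_mkord.
  by under eq_bigl do rewrite inE -(ltnS p) yE.
exists (fun i => if insub i is Some k then v 0 k else 0); split.
  move=> v_0; case/eqP: v0; apply/rowP => k; rewrite mxE.
  by have := v_0 k (ltn_ord k); rewrite valK.
move=> j; rewrite -rc => jk.
move/rowP: vM => /(_ (Ordinal jk)); rewrite !mxE => vM.
by rewrite -[RHS]vM big_mkord; apply: eq_bigr => i _; rewrite valK mxE.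
Qed.

(** The first test places the 1s of [x]. The signs and exchanged indices undo the adjugates and row
    exchanges in (A', adj B', adj C, D). *)
Definition slice_entry (K : fieldType) (M : {ffun 'Z_4 -> 'M[K]_2})
    (r c : nat) : K :=
  if (r.+1 == nth 0 x_line c)%N then 1 else
  match r, c with
  | 4, 4 => (M 0 1 0)%R | 4, 5 => (M 0 1 1)%R
  | 5, 4 => (M 0 0 0)%R | 5, 5 => (M 0 0 1)%R
  | 8, 4 => (- M 1 1 0)%R | 8, 5 => (M 1 0 0)%R
  | 9, 4 => (M 1 1 1)%R | 9, 5 => (- M 1 0 1)%R
  | 10, 6 => (M 2 1 1)%R | 10, 7 => (- M 2 0 1)%R
  | 11, 6 => (- M 2 1 0)%R | 11, 7 => (M 2 0 0)%R
  | 10, 8 => (M 3 0 0)%R | 10, 9 => (M 3 0 1)%R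
  | 11, 8 => (M 3 1 0)%R | 11, 9 => (M 3 1 1)%R
  | _, _ => 0%R
  end%N.

Definition slice_mx (K : fieldType) (M : {ffun 'Z_4 -> 'M[K]_2}) : 'M[K]_12 :=
  \matrix_(i < 12, j < 12) slice_entry M i j.

Definition slice_coords (K : fieldType) (g : 'M[K]_12) :
    {ffun 'Z_4 -> 'M[K]_2} :=
  [ffun k : 'Z_4 => \matrix_(a < 2, b < 2)
    match nat_of_ord k, nat_of_ord a, nat_of_ord b with
    | 0, 0, 0 => entry g 5 4 | 0, 0, _ => entry g 5 5
    | 0, _, 0 => entry g 4 4 | 0, _, _ => entry g 4 5
    | 1, 0, 0 => entry g 8 5 | 1, 0, _ => (- entry g 9 5)%R
    | 1, _, 0 => (- entry g 8 4)%R | 1, _, _ => entry g 9 4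
    | 2, 0, 0 => entry g 11 7 | 2, 0, _ => (- entry g 10 7)%R
    | 2, _, 0 => (- entry g 11 6)%R | 2, _, _ => entry g 10 6
    | _, 0, 0 => entry g 10 8 | _, 0, _ => entry g 10 9
    | _, _, 0 => entry g 11 8 | _, _, _ => entry g 11 9
    end%N].

Lemma Z4_ind (P : 'Z_4 -> Prop) : P 0 -> P 1 -> P 2 -> P 3 -> forall k, P k.
Proof.
move=> P0 P1 P2 P3 [[|[|[|[|//]]]] k4].
- by rewrite (_ : Ordinal k4 = 0) //; exact/val_inj.
- by rewrite (_ : Ordinal k4 = 1) //; exact/val_inj.
- by rewrite (_ : Ordinal k4 = 2) //; exact/val_inj.
- by rewrite (_ : Ordinal k4 = 3) //; exact/val_inj.
Qed.

Lemma I2_ind (P : 'I_2 -> Prop) : P 0 -> P 1 -> forall a, P a.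
Proof.
move=> P0 P1 [[|[|//]] a2].
  by rewrite (_ : Ordinal a2 = 0) //; exact/val_inj.
by rewrite (_ : Ordinal a2 = 1) //; exact/val_inj.
Qed.

Lemma slice_mxK (K : fieldType) (M : {ffun 'Z_4 -> 'M[K]_2}) :
  slice_coords (slice_mx M) = M.
Proof.
apply/ffunP; elim/Z4_ind; apply/matrixP; elim/I2_ind; elim/I2_ind;
  by rewrite ffunE mxE /= entryE //= /slice_entry /= ?opprK.
Qed.

Lemma kashiwara_saitoP (K : fieldType) (M : {ffun 'Z_4 -> 'M[K]_2}) :
  kashiwara_saito_set M <->
  (forall k, M k 0 0 * M k 1 1 - M k 0 1 * M k 1 0 = 0) /\
  (forall k a b, M k a 0 * M (k + 1) 0 b + M k a 1 * M (k + 1) 1 b = 0).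
Proof.
have sum2 (F : 'I_2 -> K) : \sum_a F a = F 0 + F 1.
  rewrite !big_ord_recl big_ord0 addr0; congr (_ + F _); exact/val_inj.
split=> [MS|[Md Mm] k].
  split=> [k|k a b]; have [Md Mm] := MS k; first by rewrite -det_mx22.
  by move/matrixP: Mm => /(_ a b); rewrite !mxE sum2.
split; first by rewrite det_mx22.
by apply/matrixP => a b; rewrite !mxE sum2.
Qed.

(** Replaces an index by numerals, on which [slice_entry] and [pivot_entry] compute. *)
Lemma nat12_ind (P : nat -> Prop) :
  P 0%N -> P 1%N -> P 2%N -> P 3%N -> P 4%N -> P 5%N -> P 6%N -> P 7%N ->
  P 8%N -> P 9%N -> P 10%N -> P 11%N -> forall i, (i < 12)%N -> P i.
Proof.
by move=> P0 P1 P2 P3 P4 P5 P6 P7 P8 P9 P10 P11; do 12?[case=> [//|]].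
Qed.

Lemma slice_schubert_GL (K : fieldType) (x y : 'S_12) (g : 'M[K]_12) :
  slice_schubert_set x y g -> GL g.
Proof. by move=> [[/opposite_chart_GL]]. Qed.

Lemma normal_slice_slice_mx (K : fieldType) (x : 'S_12) M :
  one_line x = x_line -> normal_slice x (@slice_mx K M).
Proof.
move=> xE; apply/normal_slice_entry => // r c r12 c12.
rewrite /slice_mx entryE //; move: r r12 c c12.
by apply: nat12_ind; apply: nat12_ind.
Qed.

Lemma permutation_matrix_slice_mx (K : fieldType) (x : 'S_12) :
  one_line x = x_line -> permutation_matrix K x = slice_mx 0.
Proof.
move=> xE.
have E r c : (r < 12)%N -> (c < 12)%N ->
    (r.+1 == nth 0 x_line c)%N%:R =
    slice_entry (0 : {ffun 'Z_4 -> 'M[K]_2}) r c.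
  move=> r12; move: c; move: r r12; apply: nat12_ind; apply: nat12_ind;
  rewrite /slice_entry /= ?ffunE ?mxE ?oppr0 //.
apply/matrixP => i j.
by rewrite !mxE -val_eqE -eqSS (one_line_nth _ xE) E ?ltn_ord.
Qed.

Lemma slice_coordsK (K : fieldType) (x y : 'S_12) (g : 'M[K]_12) :
  one_line x = x_line -> one_line y = y_line ->
  slice_schubert_set x y g -> slice_mx (slice_coords g) = g.
Proof.
move=> xE yE gS; have gG := slice_schubert_GL gS; case: gS => gN gZ.
have gE := proj1 (normal_slice_entry _ xE) gN.
(* Minors of size 1: an entry vanishes if no l < q has p <= y(l). The corners (p, q) used below are
   (4, 2), (8, 4) and (10, 6). *)
have z p q r c : (q <= 12)%N -> (p <= r < 12)%N -> (c < q)%N ->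
    (count (fun l => (l < q) && (p < nth 0 y_line l)) (iota 0 12) < 1)%N ->
    entry g r c = 0.
  move=> q12 pr cq pq.
  have [||v [v0 vg]] := @schubert_minor_relation K y g p q [:: r] [:: c]
    yE gG gZ erefl _ _ q12 pq; rewrite /= ?pr ?cq //.
  have /eqP := vg 0%N isT; rewrite big_nat1 mulf_eq0 => /orP[/eqP v00|/eqP //].
  by case: v0 => -[].
have g1 r c : (r < 12)%N -> (c < 12)%N -> (r.+1 == nth 0 x_line c)%N ->
    entry g r c = 1.
  by move=> r12 c12 rc; have := gE r c r12 c12; rewrite rc.
have g0 r c : (r < 12)%N -> (c < 12)%N -> (r.+1 == nth 0 x_line c)%N = false ->
    (index r.+1 x_line < c)%N || (r.+1 < nth 0 x_line c)%N -> entry g r c = 0.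
  by move=> r12 c12 rc; have := gE r c r12 c12; rewrite rc.
suff E r c : (r < 12)%N -> (c < 12)%N ->
    slice_entry (slice_coords g) r c = entry g r c.
  by apply/matrixP => i j; rewrite mxE E ?ltn_ord // /entry !inord_val.
move=> r12; move: c; move: r r12; apply: nat12_ind; apply: nat12_ind;
  rewrite /slice_entry /= ?ffunE ?mxE /= ?opprK //;
  first [by rewrite g1 | by rewrite g0 | by rewrite (z 4 2)%N
        | by rewrite (z 8 4)%N | by rewrite (z 10 6)%N].
Qed.

(** * Rank conditions give the equations of S *)

Lemma kernel_vector_eq0 (K : fieldType) (v : nat -> K) k e :
  ~ (forall i, (i < k)%N -> v i = 0) ->
  (forall i, (i < k)%N -> v i * e = 0) -> e = 0.
Proof.
move=> v0 ve; apply/eqP/negPn/negP => e0; apply: v0 => i /ve /eqP.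
by rewrite mulf_eq0 (negPf e0) orbF => /eqP.
Qed.

(** Ideal membership with explicit cofactors [c] and [d]; what remains is an identity for [ring]. *)
Lemma linear_combination0 (K : fieldType) (c d a b e : K) :
  a = 0 -> b = 0 -> e = a * c + b * d -> e = 0.
Proof. by move=> -> ->; rewrite !mul0r addr0. Qed.

(** Only 8, 7 and 10 among the first six values of [y] exceed 4, so minors of size 4 vanish. The 1s
    in rows 6, 7 and columns 2, 3 reduce such a minor to size 2. *)
Lemma slice_minor_AB (K : fieldType) (y : 'S_12)
    (M : {ffun 'Z_4 -> 'M[K]_2}) r s :
  one_line y = y_line -> GL (slice_mx M) ->
  schubert_variety y (flag_pt (slice_mx M)) ->
  r \in [:: 4; 5; 8; 9]%N -> s \in [:: 4; 5; 8; 9]%N ->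
  slice_entry M r 4 * slice_entry M s 5 = slice_entry M r 5 * slice_entry M s 4.
Proof.
move=> yE gG gZ rP sP.
have b r' : r' \in [:: 4; 5; 8; 9]%N -> [/\ (4 <= r' < 12)%N,
    slice_entry M r' 2 = 0 & slice_entry M r' 3 = 0].
  by rewrite !inE => /or4P[] /eqP ->.
have [[r12 r2 r3] [s12 s2 s3]] := (b _ rP, b _ sP).
have [|//|//|//|v [v0 vg]] := @schubert_minor_relation K y _ 4 6
  [:: 6; 7; r; s]%N [:: 2; 3; 4; 5]%N yE gG gZ erefl;
  first by rewrite /= r12 s12.
have F r' c : (4 <= r' < 12)%N -> (c < 12)%N ->
    entry (slice_mx M) r' c = slice_entry M r' c.
  by move=> /andP[_ ?] ?; rewrite entryE.
move: (vg 0%N isT) (vg 1%N isT) (vg 2 isT) (vg 3 isT).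
rewrite unlock /= !F // r2 r3 s2 s3.
rewrite (_ : slice_entry M 6 2 = 0) // (_ : slice_entry M 7 2 = 1) //.
rewrite (_ : slice_entry M 6 3 = 1) // (_ : slice_entry M 7 3 = 0) //.
rewrite (_ : slice_entry M 6 4 = 0) // (_ : slice_entry M 7 4 = 0) //.
rewrite (_ : slice_entry M 6 5 = 0) // (_ : slice_entry M 7 5 = 0) //.
rewrite !(mulr0, mulr1, addr0, add0r) => v1 v2 E4 E5.
apply/eqP; rewrite -subr_eq0; apply/eqP.
apply: (kernel_vector_eq0 v0) => -[|[|[|[|//]]]] _; rewrite ?v1 ?v2 ?mul0r //.
  apply: (linear_combination0 (c := slice_entry M s 5)
    (d := - slice_entry M s 4) E4 E5); ring.
apply: (linear_combination0 (c := - slice_entry M r 5)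
  (d := slice_entry M r 4) E4 E5); ring.
Qed.

(** Among the first ten values of [y] only 12 exceeds 10. *)
Lemma slice_minor_CD (K : fieldType) (y : 'S_12)
    (M : {ffun 'Z_4 -> 'M[K]_2}) c d :
  one_line y = y_line -> GL (slice_mx M) ->
  schubert_variety y (flag_pt (slice_mx M)) -> (c < 10)%N -> (d < 10)%N ->
  slice_entry M 10 c * slice_entry M 11 d =
  slice_entry M 10 d * slice_entry M 11 c.
Proof.
move=> yE gG gZ c10 d10.
have [//||//|//|v [v0 vg]] := @schubert_minor_relation K y _ 10 10 [:: 10; 11]%N
  [:: c; d]%N yE gG gZ erefl; first by rewrite /= c10 d10.
move: (vg 0%N isT) (vg 1%N isT).
have [c12 d12] : (c < 12)%N /\ (d < 12)%N by lia.
rewrite unlock /= !entryE // !addr0 => Ec Ed.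
apply/eqP; rewrite -subr_eq0; apply/eqP.
apply: (kernel_vector_eq0 v0) => -[|[|//]] _.
  apply: (linear_combination0 (c := slice_entry M 11 d)
    (d := - slice_entry M 11 c) Ec Ed); ring.
apply: (linear_combination0 (c := - slice_entry M 10 d)
  (d := slice_entry M 10 c) Ec Ed); ring.
Qed.

(** Among the first eight values of [y] only 10 and 12 exceed 8. The 1s in rows 8, 9 express two
    kernel coordinates through the third, and column [c] then gives C B' = 0. *)
Lemma slice_relation_CB (K : fieldType) (y : 'S_12)
    (M : {ffun 'Z_4 -> 'M[K]_2}) d c :
  one_line y = y_line -> GL (slice_mx M) ->
  schubert_variety y (flag_pt (slice_mx M)) ->
  d \in [:: 10; 11]%N -> c \in [:: 4; 5]%N ->
  slice_entry M d 6 * slice_entry M 9 c +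
  slice_entry M d 7 * slice_entry M 8 c = 0.
Proof.
move=> yE gG gZ dP cP.
have [d12 dc] : (8 <= d < 12)%N /\ slice_entry M d c = 0.
  by move: dP cP; rewrite !inE => /orP[] /eqP -> /orP[] /eqP ->.
have [c12 c8] : (c < 12)%N /\ (c < 8)%N.
  by move: cP; rewrite !inE => /orP[] /eqP ->.
have [|||//|v [v0 vg]] := @schubert_minor_relation K y _ 8 8 [:: 8; 9; d]%N
  [:: c; 6; 7]%N yE gG gZ erefl; rewrite /= ?d12 ?c8 //.
move: d12 (vg 0%N isT) (vg 1%N isT) (vg 2 isT) => /andP[_ d12].
rewrite unlock /= !entryE // dc.
rewrite (_ : slice_entry M 8 6 = 0) // (_ : slice_entry M 9 6 = 1) //.
rewrite (_ : slice_entry M 8 7 = 1) // (_ : slice_entry M 9 7 = 0) //.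
rewrite !(mulr0, mulr1, addr0, add0r) => Ec E6 E7.
have v1E : v 1%N = - (v 2 * slice_entry M d 6).
  by apply/eqP; rewrite -addr_eq0 E6.
have v0E : v 0%N = - (v 2 * slice_entry M d 7).
  by apply/eqP; rewrite -addr_eq0 E7.
have v2E : v 2 * (slice_entry M d 6 * slice_entry M 9 c +
                  slice_entry M d 7 * slice_entry M 8 c) = 0.
  apply/eqP; rewrite -oppr_eq0; apply/eqP; rewrite -[RHS]Ec v0E v1E; ring.
apply: (kernel_vector_eq0 v0) => -[|[|[|//]]] _ //.
  by rewrite v0E mulNr mulrAC v2E mul0r oppr0.
by rewrite v1E mulNr mulrAC v2E mul0r oppr0.
Qed.

(* The 7x7 minor used here gives D A' + C B' = 0.                             *)
Lemma slice_relation_DA (K : fieldType) (y : 'S_12)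
    (M : {ffun 'Z_4 -> 'M[K]_2}) d c :
  one_line y = y_line -> GL (slice_mx M) ->
  schubert_variety y (flag_pt (slice_mx M)) ->
  d \in [:: 10; 11]%N -> c \in [:: 4; 5]%N ->
  slice_entry M d 8 * slice_entry M 5 c +
  slice_entry M d 9 * slice_entry M 4 c = 0.
Proof.
move=> yE gG gZ dP cP.
have CB := slice_relation_CB yE gG gZ dP cP.
have [[d12 d4] [dc d2 d3]] : ((4 <= d < 12)%N /\ (d < 12)%N) /\
  [/\ slice_entry M d c = 0, slice_entry M d 2 = 0 & slice_entry M d 3 = 0].
  by move: dP cP; rewrite !inE => /orP[] /eqP -> /orP[] /eqP ->.
have [[c12 c10] [c6 c7]] : ((c < 12)%N /\ (c < 10)%N) /\
    (slice_entry M 6 c = 0 /\ slice_entry M 7 c = 0).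
  by move: cP; rewrite !inE => /orP[] /eqP ->.
(* Six of the first ten values of [y] exceed 4. *)
have [|||//|v [v0 vg]] := @schubert_minor_relation K y _ 4 10
  [:: 4; 5; 6; 7; 8; 9; d]%N [:: c; 2; 3; 6; 7; 8; 9]%N yE gG gZ erefl;
  rewrite /= ?d12 ?c10 //.
move: (vg 4 isT) (vg 5 isT) (vg 6 isT).
move: (vg 0%N isT) (vg 1%N isT) (vg 2 isT) (vg 3 isT).
rewrite unlock /= !entryE // dc d2 d3 c6 c7.
set A0 := slice_entry M 5 c; set A1 := slice_entry M 4 c.
set B0 := slice_entry M 9 c in CB *; set B1 := slice_entry M 8 c in CB *.
set C0 := slice_entry M d 6 in CB *; set C1 := slice_entry M d 7 in CB *.
set D0 := slice_entry M d 8; set D1 := slice_entry M d 9.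
rewrite /slice_entry /= !(mulr0, mulr1, addr0, add0r).
move=> Ec v3 v2 E6 E7 E8 E9.
have v5 : v 5 = - (v 6 * C0) by apply/eqP; rewrite -addr_eq0 E6.
have v4 : v 4 = - (v 6 * C1) by apply/eqP; rewrite -addr_eq0 E7.
have v1 : v 1%N = - (v 6 * D0) by apply/eqP; rewrite -addr_eq0 E8.
have v0' : v 0%N = - (v 6 * D1) by apply/eqP; rewrite -addr_eq0 E9.
have v6E : v 6 * (D0 * A0 + D1 * A1) = 0.
  apply: (linear_combination0 (c := - 1) (d := - v 6) Ec CB).
  by rewrite v0' v1 v4 v5; ring.
apply: (kernel_vector_eq0 v0) => -[|[|[|[|[|[|[|//]]]]]]] _ //.
- by rewrite v0' mulNr mulrAC v6E mul0r oppr0.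
- by rewrite v1 mulNr mulrAC v6E mul0r oppr0.
- by rewrite v2 mul0r.
- by rewrite v3 mul0r.
- by rewrite v4 mulNr mulrAC v6E mul0r oppr0.
- by rewrite v5 mulNr mulrAC v6E mul0r oppr0.
Qed.

Lemma slice_mx_kashiwara_saito (K : fieldType) (y : 'S_12)
    (M : {ffun 'Z_4 -> 'M[K]_2}) :
  one_line y = y_line -> GL (slice_mx M) ->
  schubert_variety y (flag_pt (slice_mx M)) -> kashiwara_saito_set M.
Proof.
move=> yE gG gZ.
have AB r s rP sP := slice_minor_AB (r := r) (s := s) yE gG gZ rP sP.
have CD c d c10 d10 := slice_minor_CD (c := c) (d := d) yE gG gZ c10 d10.
have CB d c dP cP := slice_relation_CB (d := d) (c := c) yE gG gZ dP cP.
have DA d c dP cP := slice_relation_DA (d := d) (c := c) yE gG gZ dP cP.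
have comb (a b e : K) : a = b -> e = a - b -> e = 0.
  by move=> ->; rewrite subrr.
have comb' (a b e : K) : a = b -> e = b - a -> e = 0.
  by move=> ->; rewrite subrr.
have Z3 : 3 + 1 = 0 :> 'Z_4 by exact/val_inj.
have Z2 : 2 + 1 = 3 :> 'Z_4 by exact/val_inj.
have Z1 : 1 + 1 = 2 :> 'Z_4 by exact/val_inj.
apply/kashiwara_saitoP; split.
  elim/Z4_ind.
  - by apply: (comb' _ _ _ (AB 4 5 isT isT)%N); rewrite /slice_entry /=; ring.
  - by apply: (comb' _ _ _ (AB 8 9 isT isT)%N); rewrite /slice_entry /=; ring.
  - by apply: (comb _ _ _ (CD 6 7 isT isT)%N); rewrite /slice_entry /=; ring.
  - by apply: (comb _ _ _ (CD 8 9 isT isT)%N); rewrite /slice_entry /=; ring.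
elim/Z4_ind; elim/I2_ind; elim/I2_ind; rewrite ?add0r ?Z1 ?Z2 ?Z3.
(* In blocks of four: A' adj B' = 0 and adj C D = 0 are minors of the stacked and of the adjacent
   blocks, adj B' adj C = adj (C B') comes from [CB], and D A' from [DA]. *)
- by apply: (comb _ _ _ (AB 5 8 isT isT)%N); rewrite /slice_entry /=; ring.
- by apply: (comb' _ _ _ (AB 5 9 isT isT)%N); rewrite /slice_entry /=; ring.
- by apply: (comb _ _ _ (AB 4 8 isT isT)%N); rewrite /slice_entry /=; ring.
- by apply: (comb' _ _ _ (AB 4 9 isT isT)%N); rewrite /slice_entry /=; ring.
- by apply: (comb _ _ _ (CB 11 5 isT isT)%N); rewrite /slice_entry /=; ring.
- by apply: (comb' _ _ _ (CB 10 5 isT isT)%N); rewrite /slice_entry /=; ring.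
- by apply: (comb' _ _ _ (CB 11 4 isT isT)%N); rewrite /slice_entry /=; ring.
- by apply: (comb _ _ _ (CB 10 4 isT isT)%N); rewrite /slice_entry /=; ring.
- by apply: (comb _ _ _ (CD 8 7 isT isT)%N); rewrite /slice_entry /=; ring.
- by apply: (comb _ _ _ (CD 9 7 isT isT)%N); rewrite /slice_entry /=; ring.
- by apply: (comb' _ _ _ (CD 8 6 isT isT)%N); rewrite /slice_entry /=; ring.
- by apply: (comb' _ _ _ (CD 9 6 isT isT)%N); rewrite /slice_entry /=; ring.
- by apply: (comb _ _ _ (DA 10 4 isT isT)%N); rewrite /slice_entry /=; ring.
- by apply: (comb _ _ _ (DA 10 5 isT isT)%N); rewrite /slice_entry /=; ring.
- by apply: (comb _ _ _ (DA 11 4 isT isT)%N); rewrite /slice_entry /=; ring.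
- by apply: (comb _ _ _ (DA 11 5 isT isT)%N); rewrite /slice_entry /=; ring.
Qed.

(** * Generic points of S lie in the cell of [y] *)

(* Row y(i) of this matrix is a covector supported on [y(i), 12) that kills   *)
(* the columns j < i of [slice_mx M] but not the column i.                    *)
Definition pivot_entry (K : fieldType) (M : {ffun 'Z_4 -> 'M[K]_2})
    (r c : nat) : K :=
  let g := slice_entry M in
  match r, c with
  | 0, 0 => g 11 8 * g 5 5 | 0, 1 => g 11 8 * g 5 4
  | 0, 5 => - g 11 8 | 0, 8 => - g 11 7 | 0, 9 => - g 11 6 | 0, 11 => 1
  | 1, 1 => g 9 4 | 1, 9 => - 1
  | 2, 2 => 1
  | 3, 3 => 1
  | 4, 4 => g 10 9 | 4, 5 => g 10 8 | 4, 8 => g 10 7 | 4, 9 => g 10 6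
  | 4, 10 => - 1
  | 5, 5 => g 9 4 * g 11 6 | 5, 9 => - (g 5 4 * g 11 6) | 5, 11 => g 5 4
  | 6, 6 => 1
  | 7, 7 => 1
  | 8, 8 => g 9 4 * g 11 7 | 8, 9 => - (g 8 4 * g 11 7) | 8, 11 => - g 9 4
  | 9, 9 => 1
  | 10, 10 => g 11 6 | 10, 11 => - g 10 6
  | 11, 11 => 1
  | _, _ => 0
  end.

Lemma slice_mx_cell (K : fieldType) (y : 'S_12) (M : {ffun 'Z_4 -> 'M[K]_2}) :
  one_line y = y_line -> kashiwara_saito_set M ->
  (forall k a b, M k a b != 0) -> schubert_cell y (flag_pt (slice_mx M)).
Proof.
move=> /one_line_nth yE /kashiwara_saitoP[Md Mm] M0.
have Z3 : 3 + 1 = 0 :> 'Z_4 by exact/val_inj.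
have Z2 : 2 + 1 = 3 :> 'Z_4 by exact/val_inj.
have Z1 : 1 + 1 = 2 :> 'Z_4 by exact/val_inj.
have R a b : M 0 a 0 * M 1 0 b + M 0 a 1 * M 1 1 b = 0.
  by have := Mm 0 a b; rewrite add0r.
have R1 a b : M 1 a 0 * M 2 0 b + M 1 a 1 * M 2 1 b = 0.
  by have := Mm 1 a b; rewrite Z1.
have R2 a b : M 2 a 0 * M 3 0 b + M 2 a 1 * M 3 1 b = 0.
  by have := Mm 2 a b; rewrite Z2.
have R3 a b : M 3 a 0 * M 0 0 b + M 3 a 1 * M 0 1 b = 0.
  by have := Mm 3 a b; rewrite Z3.
pose b := \matrix_(i < 12, j < 12) pivot_entry M i j.
have bgE i j : (b *m slice_mx M) (y i) j =
    \sum_(0 <= k < 12)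
      pivot_entry M (nth 0 y_line i).-1%N k * slice_entry M k j.
  by rewrite mxE big_mkord; apply: eq_bigr => k _; rewrite !mxE -yE.
apply: (@schubert_cell_pivot _ _ _ b).
- apply: borel_diag => [i j|i]; rewrite mxE.
    move: (nat_of_ord i) (ltn_ord i) (nat_of_ord j) (ltn_ord j).
    by apply: nat12_ind; apply: nat12_ind.
  move: (nat_of_ord i) (ltn_ord i).
  apply: nat12_ind; rewrite /= ?oner_eq0 //;
    by rewrite /slice_entry /= ?mulf_neq0 ?oppr_eq0.
- move=> i j; rewrite bgE.
  move: (nat_of_ord i) (ltn_ord i) (nat_of_ord j) (ltn_ord j).
  apply: nat12_ind; apply: nat12_ind; rewrite // => _;
    rewrite unlock /= /slice_entry /=; try ring.
  (* Ten entries left of a pivot do not cancel identically; each is a combination of equations of S.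
     With [d := 0] the second equation is a dummy. *)
  + by apply: (linear_combination0 (c := - M 2 1 0) (d := 0) (R 0 1) (R 0 1));
      ring.
  + by apply: (linear_combination0 (c := M 2 0 0) (d := 0) (Md 1) (Md 1)); ring.
  + by apply: (linear_combination0 (c := 1) (d := 0) (R1 1 0) (R1 1 0)); ring.
  + by apply: (linear_combination0 (c := 1) (d := 0) (R1 1 0) (R1 1 0)); ring.
  + by apply: (linear_combination0 (c := - 1) (d := 0) (R1 0 0) (R1 0 0)); ring.
  + by apply: (linear_combination0 (c := - 1) (d := 0) (Md 2) (Md 2)); ring.
  + by apply: (linear_combination0 (c := - 1) (d := 0) (R2 1 0) (R2 1 0)); ring.
  + by apply: (linear_combination0 (c := - 1) (d := 0) (R2 1 1) (R2 1 1)); ring.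
  + by apply: (linear_combination0 (c := 1) (d := 1) (R3 0 0) (R1 1 1)); ring.
  + by apply: (linear_combination0 (c := 1) (d := - 1) (R3 0 1) (R1 0 1)); ring.
(* Each pivot is, up to sign, 1 or a product of entries of [M]. *)
move=> i; rewrite bgE; move: (nat_of_ord i) (ltn_ord i).
apply: nat12_ind; rewrite unlock /= /slice_entry /=;
  rewrite !(mul0r, mulr0, mul1r, mulr1, add0r, addr0) ?oner_eq0 //;
  by rewrite ?(mulf_neq0, oppr_eq0, oner_eq0) ?M0.
Qed.

(** * Parametrization of S and passage to the closure *)

Definition plane_coord (K : fieldType) (u : K * K) (r : 'I_2) : K :=
  if r == 0 then u.1 else u.2.

Definition plane_perp (K : fieldType) (u : K * K) (s : 'I_2) : K :=
  if s == 0 then - u.2 else u.1.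

Definition ks_point (K : fieldType) (u : 'Z_4 -> K * K) (a : 'Z_4 -> K) :
    {ffun 'Z_4 -> 'M[K]_2} :=
  [ffun k => \matrix_(r < 2, s < 2)
     (a k * plane_coord (u k) r * plane_perp (u (k + 1)) s)].

Lemma ks_pointE (K : fieldType) (u : 'Z_4 -> K * K) (a : 'Z_4 -> K) k r s :
  ks_point u a k r s = a k * plane_coord (u k) r * plane_perp (u (k + 1)) s.
Proof. by rewrite ffunE mxE. Qed.

(** Each matrix has rank at most 1, and consecutive products contain the factor perp u . u = 0. *)
Lemma ks_point_kashiwara_saito (K : fieldType) (u : 'Z_4 -> K * K) a :
  kashiwara_saito_set (ks_point u a).
Proof.
apply/kashiwara_saitoP; split=> [k|k r s]; rewrite !ks_pointE;
  rewrite /plane_coord /plane_perp /=; ring.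
Qed.

(* An adapted vector u spans a line between the image of N and the kernel of  *)
(* P.                                                                         *)
Lemma adapted_vector (K : fieldType) (P N : 'M[K]_2) :
  P 0 0 * P 1 1 - P 0 1 * P 1 0 = 0 -> N 0 0 * N 1 1 - N 0 1 * N 1 0 = 0 ->
  (forall a b, P a 0 * N 0 b + P a 1 * N 1 b = 0) ->
  exists u : K * K, [/\ (u.1 != 0) || (u.2 != 0),
    forall b, N 0 b * u.2 = N 1 b * u.1 &
    forall a, P a 0 * u.1 + P a 1 * u.2 = 0].
Proof.
move=> dP dN PN; have [N0|Nn0] := eqVneq N 0; last first.
  have [b Nb] : exists b, (N 0 b != 0) || (N 1 b != 0).
    apply: contrapT => H; case/eqP: Nn0; apply/matrixP => r s; rewrite mxE.
    apply/eqP/negPn/negP => Nrs; apply: H; exists s.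
    by elim/I2_ind: r Nrs => ->; rewrite ?orbT.
  (* For nonzero [N], any nonzero column spans its image. *)
  exists (N 0 b, N 1 b); split=> //= b'.
  apply/eqP; rewrite -subr_eq0; apply/eqP.
  move: dN; elim/I2_ind: b {Nb}; elim/I2_ind: b' => dN; try ring.
    by apply: (linear_combination0 (c := - 1) (d := 0) dN dN); ring.
  by apply: (linear_combination0 (c := 1) (d := 0) dN dN); ring.
(* For [N = 0], a nonzero row of [P], rotated, spans its kernel; if [P] is zero too, any vector
   serves. *)
have kerP r : exists2 u : K * K, u = (- P r 1, P r 0) &
    forall a, P a 0 * u.1 + P a 1 * u.2 = 0.
  exists (- P r 1, P r 0) => // a /=.
  elim/I2_ind: r; elim/I2_ind: a; try ring.
    by apply: (linear_combination0 (c := 1) (d := 0) dP dP); ring.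
  by apply: (linear_combination0 (c := - 1) (d := 0) dP dP); ring.
have [[r Pr]|H] := pselect (exists r, (- P r 1 != 0) || (P r 0 != 0)).
  have [u uE Pu] := kerP r; exists u; split=> [|b|//]; first by rewrite uE.
  by rewrite N0 !mxE !mul0r.
exists (1, 0); split=> [|b|a]; rewrite ?oner_eq0 //= ?N0 ?mxE ?mul0r //.
suff -> : P a 0 = 0 by rewrite mulr0 mul0r addr0.
by apply/eqP/negPn/negP => Pa; apply: H; exists a; rewrite Pa orbT.
Qed.

(** Columns proportional to u give N = u c^T; then N v = 0 makes c orthogonal to v, hence a multiple
    of perp v. *)
Lemma rank1_factor (K : fieldType) (N : 'M[K]_2) (u v : K * K) :
  (u.1 != 0) || (u.2 != 0) -> (v.1 != 0) || (v.2 != 0) ->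
  (forall b, N 0 b * u.2 = N 1 b * u.1) ->
  (forall a, N a 0 * v.1 + N a 1 * v.2 = 0) ->
  exists a, forall r s, N r s = a * plane_coord u r * plane_perp v s.
Proof.
move=> u0 v0 Nu Nv.
have [c cE] : exists c : 'I_2 -> K, forall r s, N r s = plane_coord u r * c s.
  have [u1|u1] := boolP (u.1 != 0).
    exists (fun s => N 0 s / u.1); elim/I2_ind => s; rewrite /plane_coord /=.
      by field.
    by apply: (mulIf u1); rewrite -Nu; field.
  move: u0; rewrite (negPf u1) /= => u2; exists (fun s => N 1 s / u.2).
  elim/I2_ind => s; rewrite /plane_coord /=; last by field.
  by apply: (mulIf u2); rewrite Nu; field.
have cv : c 0 * v.1 + c 1 * v.2 = 0.
  have E r : plane_coord u r * (c 0 * v.1 + c 1 * v.2) = 0.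
    by rewrite -[RHS](Nv r) !cE; ring.
  case/orP: u0 => u0; first by apply: (mulfI u0); rewrite mulr0; exact: (E 0).
  by apply: (mulfI u0); rewrite mulr0; exact: (E 1).
suff [a aE] : exists a, forall s, c s = a * plane_perp v s.
  by exists a => r s; rewrite cE aE mulrCA mulrA.
have [v1|v1] := boolP (v.1 != 0).
  exists (c 1 / v.1); elim/I2_ind; rewrite /plane_perp /=; last by field.
  by apply: (mulIf v1); apply/eqP; rewrite -subr_eq0 -cv; apply/eqP; field.
move: v0; rewrite (negPf v1) /= => v2; exists (- c 0 / v.2).
elim/I2_ind; rewrite /plane_perp /=; first by field.
apply: (mulIf v2); apply/eqP; rewrite -subr_eq0 -cv; apply/eqP; field.
exact: v2.
Qed.

(** One vector u_k, adapted to M_(k-1) and M_k, serves both as kernel direction of the former and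
    image direction of the latter; this makes the choices fit around the cycle. *)
Lemma kashiwara_saito_ks_point (K : fieldType) (M : {ffun 'Z_4 -> 'M[K]_2}) :
  kashiwara_saito_set M -> exists u a, M = ks_point u a.
Proof.
move=> /kashiwara_saitoP[Md Mm].
have /choice[u uP] k : exists u : K * K, [/\ (u.1 != 0) || (u.2 != 0),
    forall b, M k 0 b * u.2 = M k 1 b * u.1 &
    forall a, M (k - 1) a 0 * u.1 + M (k - 1) a 1 * u.2 = 0].
  by apply: adapted_vector => // a b; have := Mm (k - 1) a b; rewrite subrK.
have /choice[a aP] k : exists a, forall r s,
    M k r s = a * plane_coord (u k) r * plane_perp (u (k + 1)) s.
  have [uk Mu _] := uP k; have [vk _ Mv] := uP (k + 1).
  by apply: rank1_factor => // a; have := Mv a; rewrite addrK.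
by exists u, a; apply/ffunP => k; apply/matrixP => r s; rewrite ks_pointE.
Qed.

Lemma polynomial_map_slice_mx (K : fieldType) : polynomial_map (@slice_mx K).
Proof.
have polyM k a b := @polynomial_fun_ffun_entry K 'Z_4 2 2 k a b.
apply: polynomial_map_mx => i j.
have -> : (fun M : {ffun 'Z_4 -> 'M[K]_2} => slice_mx M i j) =
    fun M => slice_entry M i j.
  by apply: funext => M; rewrite mxE.
move: (nat_of_ord i) (ltn_ord i) (nat_of_ord j) (ltn_ord j).
apply: nat12_ind; apply: nat12_ind; rewrite /slice_entry /=;
  first [exact: polynomial_fun_cst | exact: polyM
        | apply: polynomial_funN; exact: polyM].
Qed.

Lemma polynomial_map_slice_coords (K : fieldType) :
  polynomial_map (@slice_coords K).
Proof.
have polyg r c : polynomial_fun (fun g : 'M[K]_12 => entry g r c).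
  exact: polynomial_fun_entry.
apply: polynomial_map_ffun_mx => k a b.
under [X in polynomial_fun X]eq_fun do rewrite ffunE mxE.
elim/Z4_ind: k; elim/I2_ind: a; elim/I2_ind: b => /=;
  first [exact: polyg | apply: polynomial_funN; exact: polyg].
Qed.

Lemma slice_mx_schubert_variety (K : fieldType) (x y : 'S_12)
    (M : {ffun 'Z_4 -> 'M[K]_2}) :
  [pchar K] =i pred0 -> one_line x = x_line -> one_line y = y_line ->
  kashiwara_saito_set M -> schubert_variety y (flag_pt (slice_mx M)).
Proof.
move=> K0 xE yE /kashiwara_saito_ks_point[u [a ->]].
have gG N : GL (@slice_mx K N).
  by have [/opposite_chart_GL] := normal_slice_slice_mx N xE.
apply: schubert_variety_dense => // f fP f0.
(* Adding [t] to every parameter makes each factor of [h] below a monic polynomial of degree 1, so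
   [h] is nonzero whatever the point; where [h] does not vanish, all entries of [N t] are
   nonzero. *)
pose N (t : K^o) :=
  ks_point (fun k => ((u k).1 + t, (u k).2 + t)) (fun k => a k + t).
have -> : ks_point u a = N 0.
  apply/ffunP => k; apply/matrixP => r s; rewrite !ks_pointE.
  by rewrite /plane_coord /plane_perp /= !addr0.
pose h : {poly K} := \prod_k
  (((u k).1%:P + 'X) * ((u k).2%:P + 'X) * ((a k)%:P + 'X)).
apply: (@polynomial_fun_eq0_generic K (f \o (fun t => slice_mx (N t))) h) => //.
- apply: polynomial_fun_comp => //.
  apply: polynomial_map_mx => i j.
  apply: (@polynomial_fun_comp _ _ _ N (fun M => slice_mx M i j)).
    apply: polynomial_map_ffun_mx => k r s.
    under [X in polynomial_fun X]eq_fun do rewrite ks_pointE.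
    have lin c : polynomial_fun (fun t : K^o => c + t).
      apply: polynomial_funD; first exact: polynomial_fun_cst.
      by apply: polynomial_fun_linear => ? ? ?.
    apply: polynomial_funM.
      apply: polynomial_funM => //; rewrite /plane_coord.
      by case: (r == 0) => /=.
    by rewrite /plane_perp; case: (s == 0) => //=; exact: polynomial_funN.
  apply: (polynomial_fun_comp (phi := @slice_mx K)
    (f := fun g : 'M[K]_12 => g i j)).
    exact: polynomial_map_slice_mx.
  exact: polynomial_fun_entry.
- have lin0 (c : K) : c%:P + 'X != 0.
    by rewrite addrC -size_poly_eq0 size_XaddC.
  by apply/prodf_neq0 => k _; rewrite !mulf_neq0.
move=> t; rewrite horner_prod => /prodf_neq0 ht; apply: f0 => //.
apply: slice_mx_cell => //; first exact: ks_point_kashiwara_saito.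
have ut k : [/\ (u k).1 + t != 0, (u k).2 + t != 0 & a k + t != 0].
  have := ht k isT; rewrite !hornerE !mulf_eq0 !negb_or.
  by move=> /andP[/andP[]].
move=> k r s; rewrite ks_pointE /plane_coord /plane_perp.
have [[u1 u2 ak] [v1 v2 _]] := (ut k, ut (k + 1)).
by rewrite !mulf_neq0 //; case: ifP; rewrite /= ?oppr_eq0.
Qed.

Lemma slice_schubert_kashiwara_saito (K : fieldType) (x y : 'S_12) :
  [pchar K] =i pred0 -> one_line x = x_line -> one_line y = y_line ->
  pointed_isomorphic (slice_schubert K x y) (permutation_matrix K x)
                     (kashiwara_saito K) 0.
Proof.
move=> K0 xE yE.
have S0 : kashiwara_saito_set (0 : {ffun 'Z_4 -> 'M[K]_2}).
  apply/kashiwara_saitoP; split=> *; rewrite !ffunE !mxE !mul0r ?subr0 //.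
  exact: addr0.
have sliceS M : kashiwara_saito_set M -> slice_schubert_set x y (@slice_mx K M).
  move=> MS; split; first exact: normal_slice_slice_mx.
  exact: slice_mx_schubert_variety xE yE MS.
split=> //; first by rewrite permutation_matrix_slice_mx //; exact: sliceS.
exists (@slice_coords K), (@slice_mx K); split.
- exact: polynomial_map_slice_coords.
- exact: polynomial_map_slice_mx.
- move=> g gS; have gK := slice_coordsK xE yE gS; split=> //.
  apply: (slice_mx_kashiwara_saito yE); rewrite gK; last by case: gS.
  exact: slice_schubert_GL gS.
- by move=> M MS; split; [exact: sliceS|exact: slice_mxK].
- by rewrite permutation_matrix_slice_mx // slice_mxK.
Qed.

Theorem proposition3p3 (R : realType) (x y : 'S_12)
  (hx : one_line x = [:: 4; 3; 8; 7; 2; 1; 10; 9; 6; 5; 12; 11]%N)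
  (hy : one_line y = [:: 4; 3; 8; 7; 10; 2; 12; 6; 9; 1; 11; 5]%N) :
  pointed_isomorphic (slice_schubert R[i] x y) (permutation_matrix R[i] x)
                     (kashiwara_saito R[i]) 0.
Proof.
exact: slice_schubert_kashiwara_saito (Num.Theory.pchar_num _) hx hy.
Qed.
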